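(* Let $X$ be a Tychonoff space such that $C_k(X)$ is sequentially separable. Then the following statements are equivalent: (1) $C_k(X)$ satisfies $S_{1}(\mathcal{S},\mathcal{S})$; (2) $C_k(X)$ satisfies $S_{1}(\mathcal{S},\Gamma_{\mathbf 0})$; (3) $C_k(X)$ satisfies $S_{1}(\Gamma_{\mathbf 0},\Gamma_{\mathbf 0})$ (property $\alpha_2$); (4) $X$ satisfies $S_{1}(\Gamma^{sh}_k,\Gamma_k)$; (5) $C_k(X)$ satisfies $S_{fin}(\mathcal{S},\mathcal{S})$ (i.e. $C_k(X)$ is selectively sequentially separable); (6) $C_k(X)$ satisfies $S_{fin}(\mathcal{S},\Gamma_{\mathbf 0})$; (7) $C_k(X)$ satisfies $S_{fin}(\Gamma_{\mathbf 0},\Gamma_{\mathbf 0})$ (property $\alpha_4$); (8) $X$ satisfies $S_{fin}(\Gamma^{sh}_{k},\Gamma_{k})$.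
   Context: Function space: for a Tychonoff space $X$, $C_k(X)$ is the space of all real-valued continuous functions on $X$ with the compact-open topology; basic neighborhoods of $f$ are $\{g\in C(X): |f(x)-g(x)|<\epsilon \ \forall x\in A\}$ with $A\subseteq X$ compact and $\epsilon>0$. $\mathbf 0$ denotes the constantly zero function in $C_k(X)$. Sequential density: a subset $D$ of a space $Y$ is sequentially dense in $Y$ if every point of $Y$ is the limit of a convergent sequence of elements of $D$. $Y$ is sequentially separable if it has a countable sequentially dense subset. $\mathcal{S}$ is the family of sequentially dense subsets of $C_k(X)$. Convergent sets: a subset $A$ of a space $Y$ converges to $y\in Y$ (written $y=\lim A$) if $A$ is infinite, $y\notin A$, and $A\setminus U$ is finite for each neighborhood $U$ of $y$. $\Gamma_y=\{A\subseteq Y: y=\lim A\}$; one may regard $\Gamma_y$ as the set of non-trivial sequences converging to $y$. Here $\Gamma_{\mathbf 0}$ is taken in $Y=C_k(X)$. A space $Y$ has property $\alpha_2$ (resp. $\alpha_4$) if it satisfies $S_1(\Gamma_y,\Gamma_y)$ (resp. $S_{fin}(\Gamma_y,\Gamma_y)$) for every $y\in Y$; since $C_k(X)$ is homogeneous, one works with $y=\mathbf 0$. Selection principles: let $\mathcal{A},\mathcal{B}$ be collections of families (sets). $S_{1}(\mathcal{A},\mathcal{B})$: for each sequence $(A_{n}: n\in \mathbb{N})$ of elements of $\mathcal{A}$ there is a sequence $(b_{n})_{n\in \mathbb{N}}$ such that $b_{n}\in A_{n}$ for each $n$ and $\{b_{n}: n\in\mathbb{N}\}\in\mathcal{B}$.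 $S_{fin}(\mathcal{A},\mathcal{B})$: for each sequence $(A_{n}: n\in \mathbb{N})$ of elements of $\mathcal{A}$ there is a sequence $(B_{n})_{n\in \mathbb{N}}$ of finite sets such that $B_{n}\subseteq A_{n}$ for each $n$ and $\bigcup_{n\in\mathbb{N}}B_{n}\in\mathcal{B}$. Covers: a family $\mathcal{U}$ of subsets of $X$ is a $\gamma_k$-cover of $X$ if it is a cover of $X$, is infinite, $X\notin \mathcal{U}$, and for each compact $C\subseteq X$ the set $\{U\in \mathcal{U} : C\nsubseteq U\}$ is finite. $\Gamma_k$ is the family of open $\gamma_k$-covers of $X$. A $\gamma_k$-cover $\mathcal{U}$ of $X$ by co-zero sets is $\gamma_k$-shrinkable if there exists a $\gamma_k$-cover $\{F(U) : U\in \mathcal{U}\}$ of $X$ by zero-sets with $F(U)\subset U$ for every $U\in \mathcal{U}$. $\Gamma^{sh}_k$ is the family of $\gamma_k$-shrinkable $\gamma_k$-covers of $X$. *)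

(* Defs.v *)
From HB Require Import structures.
From mathcomp Require Import all_boot all_order all_algebra.
From mathcomp Require Import all_classical all_reals all_analysis.

Set Implicit Arguments.
Unset Strict Implicit.
Unset Printing Implicit Defensive.

Import Order.TTheory GRing.Theory Num.Theory.
Import numFieldNormedType.Exports.

Local Open Scope classical_set_scope.
Local Open Scope ring_scope.

Definition tychonoff_space (X : topologicalType) : Prop :=
  completely_regular_space X /\ hausdorff_space X.

(* The compact-open topology of the library lives on all functions X -> R;
   Ck X R is the subspace of continuous ones. *)
Definition Ck (X : topologicalType) (R : realType) : topologicalType :=
  initial_topology
    (fun f : continuousType X R => (f : X -> R) : {compact-open, X -> R}).

Definition Ck0 (X : topologicalType) (R : realType) : Ck X R :=
  (cst 0 : X -> R) : continuousType X R.

Section selection_principles.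
Context {T : Type}.
Implicit Types A B : set (set T).

Definition S1 A B : Prop :=
  forall a : nat -> set T, (forall n, A (a n)) ->
  exists b : nat -> T, (forall n, a n (b n)) /\ B (range b).

Definition Sfin A B : Prop :=
  forall a : nat -> set T, (forall n, A (a n)) ->
  exists b : nat -> set T,
    (forall n, finite_set (b n) /\ b n `<=` a n) /\ B (\bigcup_n b n).

End selection_principles.

Section sequences_in_spaces.
Context {Y : topologicalType}.

Definition seq_dense (D : set Y) : Prop :=
  forall y : Y, exists u : nat -> Y, (forall n, D (u n)) /\ u @ \oo --> y.

Definition seq_separable : Prop :=
  exists D : set Y, countable D /\ seq_dense D.

Definition Gamma_at (y : Y) : set (set Y) :=
  [set A | [/\ infinite_set A, ~ A y &
            forall U, nbhs y U -> finite_set (A `\` U)]].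

End sequences_in_spaces.

Arguments seq_separable : clear implicits.

Section covers.
Context {X : topologicalType}.

Definition gamma_k_cover (U : set (set X)) : Prop :=
  [/\ \bigcup_(V in U) V = setT, infinite_set U, ~ U setT &
      forall C, compact C -> finite_set [set V | U V /\ ~ C `<=` V]].

Definition Gamma_k : set (set (set X)) :=
  [set U | gamma_k_cover U /\ forall V, U V -> open V].

Definition zero_set (R : realType) (Z : set X) : Prop :=
  exists f : X -> R, continuous f /\ Z = [set x | f x = 0].

Definition cozero_set (R : realType) (V : set X) : Prop :=
  exists f : X -> R, continuous f /\ V = [set x | f x != 0].

Definition Gamma_k_sh (R : realType) : set (set (set X)) :=
  [set U | [/\ gamma_k_cover U, forall V, U V -> cozero_set R V &
     exists F : set X -> set X,
       [/\ forall V, U V -> zero_set R (F V) /\ F V `<=` V &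
           gamma_k_cover (F @` U)]]].

End covers.

Arguments Gamma_k : clear implicits.
Arguments Gamma_k_sh : clear implicits.

(* The sets [set g | forall x, A x -> `|f x - g x| < e], with A compact and
   0 < e, form a neighborhood base at f. *)
Lemma Ck_nbhsP (X : topologicalType) (R : realType) (f : Ck X R)
    (W : set (Ck X R)) :
  nbhs f W <-> exists (A : set X) (e : R), [/\ compact A, 0 < e &
    [set g : Ck X R | forall x, A x -> `|f x - g x| < e] `<=` W].
Proof.
pose B (p : set X * R) : set (X -> R) :=
  [set g | forall x, p.1 x -> `|f x - g x| < p.2].
pose D : set (set X * R) := [set p | compact p.1 /\ 0 < p.2].
pose F : set_system (X -> R) := filter_from D B.
have FF : Filter F.
  apply: filter_from_filter; first by exists (set0, 1); split => //; exact: compact0.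
  move=> [A e] [A' e'] [cA e0] [cA' e'0].
  exists (A `|` A', Num.min e e'); first by split; [exact: compactU|rewrite lt_min; apply/andP].
  move=> g gB; split=> x xA; have := gB x.
    by move=> /(_ (or_introl xA)); rewrite lt_min => /andP[].
  by move=> /(_ (or_intror xA)); rewrite lt_min => /andP[].
have cf : continuous (f : X -> R) by exact: cts_fun.
split=> [|[A [e [cA e0 sW]]]].
  case=> _ [[V oV <-] Vf sW].
  have /(compact_open_fam_compactP cf) : {family compact, F --> (f : X -> R)}.
    apply/fam_cvgP => A cA U; rewrite uniform_nbhs => -[E [entE sU]].
    move: entE; rewrite -entourage_ballE => -[e /= e0 sE].
    by exists (A, e) => // g gA; apply: sU => x xA; apply: sE; exact: gA.
  move=> /(_ V); case; first exact: open_nbhs_nbhs.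
  by move=> [A e] [cA e0] sV; exists A, e; split => // g gA; apply/sW/sV.
have : nbhs (f : {compact-open, X -> R}) `=>` nbhs (f : {family compact, X -> R}).
  exact/(compact_open_fam_compactP cf).
move=> /fam_cvgP /(_ A cA (B (A, e))) nB.
apply: (filterS sW).
apply: (@initial_continuous (continuousType X R) {compact-open, X -> R}
  (fun f => (f : X -> R)) f (B (A, e))).
apply: nB; rewrite uniform_nbhs; exists [set xy | ball xy.1 e xy.2]; split.
  by rewrite -entourage_ballE; exists e.
by move=> g gA x xA; exact: gA.
Qed.

(* Main.v *)
Require Import Defs.
From HB Require Import structures.
From mathcomp Require Import all_boot all_order all_algebra.
From mathcomp Require Import all_classical all_reals all_analysis.
From mathcomp Require Import lra.

Set Implicit Arguments.
Unset Strict Implicit.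
Unset Printing Implicit Defensive.

Import Order.TTheory GRing.Theory Num.Theory.
Import numFieldNormedType.Exports.

Local Open Scope classical_set_scope.
Local Open Scope ring_scope.

(** Every one of the eight principles is equivalent to a diagonal property of
    real-valued functions, [alpha2]: if for each [n] the continuous functions
    [F n 0, F n 1, ...] tend to zero uniformly on compact sets, then some
    diagonal [F n (phi n)] does so too.

    From [alpha2] to the four S_1 principles ([alpha2_S1_dense],
    [alpha2_S1_dense_Gamma], [alpha2_S1_Gamma], [alpha2_S1_cover]) each given
    set supplies a row of functions converging to a prescribed target, and
    the diagonal of the differences is null. For S_1(S, S) the targets run
    through a countable sequentially dense sequence [d], each [d i] being the
    target of infinitely many rows, so that the selected functions follow
    every sequence of values of [d].
    For S_1(S, Gamma_0) the n-th target is the constant 1/(n+1), which keeps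
    the selected functions different from zero; for S_1(Gamma^sh, Gamma) the
    functions separate the zero-sets of a shrinking from the complements of
    the co-zero sets.

    Each S_1 principle implies its S_fin version, so it remains to derive
    [alpha2] from the four S_fin principles. Two reductions make this uniform.
    First, replacing [F n m] by [G n m], which is n + 1 times the sum of
    [`|F i m|] over [i <= n], a selection that meets infinitely many rows
    already controls all of them: if [G n m < 1] on a set for some [n >= j],
    then [`|F j m| < 1 / (j + 1)] there. Second, if some [G n m] with
    arbitrarily large [n] is smaller than 1 everywhere, there is nothing to
    do; otherwise the first rows can be dropped, and each [G n m] takes
    a value at least 1 somewhere. This is [late_bound_alpha2]. After it,
    - the functions [G n m] form sets converging to zero, for
      S_fin(Gamma_0, Gamma_0) ([Sfin_Gamma_alpha2]);
    - the proper open sets [G n m < 1], which contain the zero-sets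
      [G n m <= 1/2], form shrinkable covers, for S_fin(Gamma^sh, Gamma)
      ([Sfin_cover_alpha2]);
    - for the two principles that start from dense sets, the functions that
      equal [d i] where [G n m <= 1/2] and 1 where [G n m >= 1] are
      sequentially dense for each fixed [n], none of them is zero, and where
      such a function is smaller than 1 one has [G n m < 1]
      ([dense_selection_alpha2]).

    A union of finite sets [B n] that is infinite has members in [B n] for
    arbitrarily large [n], and these leave every finite set
    ([bigcup_escaping]); hence they inherit the convergence of the union. *)

Lemma S1_Sfin {T : Type} (A B : set (set T)) : S1 A B -> Sfin A B.
Proof.
move=> sel a Aa; have [b [ab Bb]] := sel a Aa.
exists (fun n => [set b n]); split=> [n|].
  by split=> [|_ ->]; [exact: finite_set1 | exact: ab].
by rewrite bigcup_imset1.
Qed.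

(** * Sequences that leave every finite set *)

Lemma finite_nat_near (E : set nat) :
  finite_set E -> \forall n \near \oo, ~ E n.
Proof.
move=> /finite_seqP[s Es]; exists (\max_(k <- s) k).+1 => // n /= ltn En.
have ns : n \in s by rewrite Es in En.
by have := @leq_bigmax_seq _ s xpredT id n ns isT; rewrite leqNgt ltn.
Qed.

Section escaping_sequences.
Context {T : Type}.

(** Convergence of a set is tested on its sequences of this kind: whatever
    holds for all but finitely many elements of the set holds eventually along
    the sequence. *)
Definition escaping (v : nat -> T) : Prop :=
  forall E, finite_set E -> \forall j \near \oo, ~ E (v j).

Lemma escaping_infinite (v : nat -> T) : escaping v -> infinite_set (range v).
Proof.
move=> ev finv; have [N _ /(_ N (leqnn N))] := ev _ finv.
by apply; exists N.
Qed.

Lemma infinite_escaping (A : set T) : infinite_set A ->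
  exists v : nat -> T, (forall n, A (v n)) /\ escaping v.
Proof.
move=> /infiniteP/card_leP[f].
pose i (n : nat) : [set: nat] := SigSub (mem_set (I : [set: nat] n)).
exists (fun n => val (f (i n))); split=> [n|E finE]; first exact: set_valP.
have finI : finite_set ((fun n => val (f (i n))) @^-1` E).
  apply: finite_preimage finE => m n _ _ /val_inj fmn.
  have : i m = i n by apply: (@inj _ _ _ f) fmn; rewrite inE.
  by move=> /(congr1 val).
exact: finite_nat_near finI.
Qed.

(** What a finite selection leaves of the infinitely many rows: as each
    initial union is finite, the j-th term can be chosen outside the first [j]
    sets, and then it lies in a later one. *)
Lemma bigcup_escaping (B : nat -> set T) :
  (forall n, finite_set (B n)) -> infinite_set (\bigcup_n B n) ->
  exists (nu : nat -> nat) (v : nat -> T),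
    [/\ forall j, (j <= nu j)%N, forall j, B (nu j) (v j) & escaping v].
Proof.
move=> finB infB.
have finU j : finite_set (\bigcup_(n in `I_j) B n) by exact: bigcup_finite.
have pick j : {p : nat * T |
    [/\ (j <= p.1)%N, B p.1 p.2 & forall n, (n < j)%N -> ~ B n p.2]}.
  apply: cid; have /infinite_setN0[x [[n _ Bnx] xU]] :
      infinite_set (\bigcup_n B n `\` \bigcup_(n in `I_j) B n).
    exact: infinite_setD.
  exists (n, x); split=> //= [|m mj Bmx]; last by apply: xU; exists m.
  by rewrite leqNgt; apply/negP => nj; apply: xU; exists n.
exists (fun j => (sval (pick j)).1), (fun j => (sval (pick j)).2).
split=> [j|j|E finE]; try by case: (svalP (pick j)).
(* [b x] is the index of one of the sets containing [x]; a bound on [b] over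
   [E] is passed by [j], after which [v j] avoids all these sets. *)
have [b bP] : exists b : T -> nat, forall n x, B n x -> B (b x) x.
  suff : forall x, exists m, forall n, B n x -> B m x.
    by move=> /choice[b bP]; exists b => n x; exact: bP.
  move=> x; have [[m Bm]|nB] := pselect (exists m, B m x); first by exists m.
  by exists 0 => n Bn; exfalso; apply: nB; exists n.
have [N _ NE] := finite_nat_near (finite_image b finE).
exists N => // j /= Nj Ej; case: (svalP (pick j)) => _ Bj nB.
apply: nB (bP _ _ Bj); apply: leq_trans Nj; rewrite ltnNge; apply/negP => /NE.
by apply; exists (sval (pick j)).2.
Qed.
End escaping_sequences.

(** * Sets converging to a point *)

Section gamma_at.
Context {Y : topologicalType}.

Lemma Gamma_at_cvg (y : Y) (A : set Y) (v : nat -> Y) :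
  Gamma_at y A -> (forall n, A (v n)) -> escaping v -> v @ \oo --> y.
Proof.
move=> [_ _ AU] Av ev U /AU /ev; apply: filterS => n nAU.
by apply: contrapT => nU; apply: nAU.
Qed.

Lemma cvg_Gamma_at (y : Y) (u : nat -> Y) : accessible_space Y ->
  u @ \oo --> y -> (forall n, u n <> y) -> Gamma_at y (range u).
Proof.
move=> T1 uy neq; have nRy : ~ range u y by case=> n _ /neq.
split=> // [finR|U /uy [N _ NU]].
  have /uy : nbhs y (~` range u).
    apply: open_nbhs_nbhs; split=> //; apply: closed_openC.
    exact: (accessible_finite_set_closed.1 T1).
  by case=> N _ /(_ N (leqnn N)); apply; exists N.
apply: (@sub_finite_set _ _ (u @` `I_N)); last exact: finite_image.
move=> _ [[n _ <-] nU]; exists n => //=.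
by rewrite ltnNge; apply/negP => /NU.
Qed.

End gamma_at.

(** * Covers indexed by a family *)

Section gamma_k.
Context {X : topologicalType}.

(** The point is that the image is infinite although [v] may repeat values:
    if it were finite, one point outside each of its members would give a
    finite, hence compact, set contained in no [v i]. *)
Lemma gamma_k_cover_image {I : Type} (D : set I) (v : I -> set X) :
  infinite_set D -> (forall i, D i -> v i <> setT) ->
  (forall C, compact C -> finite_set [set i | D i /\ ~ C `<=` v i]) ->
  gamma_k_cover (v @` D).
Proof.
move=> infD vT fin.
have sub C : [set V | (v @` D) V /\ ~ C `<=` V] `<=`
    v @` [set i | D i /\ ~ C `<=` v i].
  by move=> _ [[i Di <-] nC]; exists i.
split.
- apply/seteqP; split=> // x _.
  have /infinite_setN0[i [Di nB]] :
      infinite_set (D `\` [set i | D i /\ ~ [set x] `<=` v i]).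
    by apply: infinite_setD => //; exact/fin/compact_set1.
  exists (v i); first by exists i.
  by apply: contrapT => nvx; apply: nB; split=> // /(_ x erefl).
- move=> finv.
  have [p pP] : exists p : set X -> option X,
      forall V, (v @` D) V -> exists2 x, p V = Some x & ~ V x.
    suff /choice[p pP] : forall V, exists o : option X,
        (v @` D) V -> exists2 x, o = Some x & ~ V x by exists p.
    move=> V; have [[i Di <-]|nV] := pselect ((v @` D) V); last first.
      by exists None => /nV.
    have /existsNP[x nvx] : ~ forall x, v i x.
      by move=> vx; apply: (vT i Di); apply/seteqP; split.
    by exists (Some x) => _; exists x.
  pose C := [set x | (p @` (v @` D)) (Some x)].
  have finC : finite_set C.
    by apply: (@finite_preimage _ _ _ Some) => [? ? _ _ []//|]; exact: finite_image.
  apply: infD; apply: sub_finite_set (fin C (finite_compact finC)) => i Di.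
  split=> // CV; have [|x px nVx] := pP (v i); first by exists i.
  by apply/nVx/CV; exists (v i) => //; exists i.
- by case=> i /vT.
- by move=> C cC; apply: sub_finite_set (sub C) _; exact/finite_image/fin.
Qed.

Lemma gamma_k_cover_range (v : nat -> set X) :
  (forall n, v n <> setT) ->
  (forall C, compact C -> \forall n \near \oo, C `<=` v n) ->
  gamma_k_cover (range v).
Proof.
move=> vT vC; apply: gamma_k_cover_image => //; first exact: infinite_nat.
move=> C /vC[N _ NC]; apply: sub_finite_set (finite_II N) => n [_ nC] /=.
by rewrite ltnNge; apply/negP => /NC.
Qed.

Lemma gamma_k_cover_near (U : set (set X)) (v : nat -> set X) (C : set X) :
  gamma_k_cover U -> (forall n, U (v n)) -> escaping v -> compact C ->
  \forall n \near \oo, C `<=` v n.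
Proof.
move=> [_ _ _ fin] Uv ev /fin /ev; apply: filterS => n nC.
by apply: contrapT => nCv; apply: nC.
Qed.

End gamma_k.

(** * Uniform convergence to zero on compact sets *)

Section function_space.
Context {R : realType} {X : topologicalType}.
Implicit Types (f g h : X -> R) (u : nat -> X -> R).

Definition Ck_of h (ch : continuous h) : Ck X R := mkcts ch.

Lemma Ck_continuous (f : Ck X R) : continuous (f : X -> R).
Proof. exact: (@cts_fun _ _ f). Qed.

Definition k_null u : Prop := forall C e, compact C -> 0 < e ->
  \forall n \near \oo, forall x, C x -> `|u n x| < e.

Lemma Ck_cvgP (u : nat -> Ck X R) (f : Ck X R) :
  u @ \oo --> f <-> k_null (fun n x => u n x - f x).
Proof.
split=> [uf C e cC e0|uf W /Ck_nbhsP[C [e [cC e0 sW]]]].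
  have /uf[N _ NP] : nbhs f [set g : Ck X R | forall x, C x -> `|f x - g x| < e].
    by apply/Ck_nbhsP; exists C, e; split.
  by exists N => // n /NP un x /un; rewrite distrC.
have := uf C e cC e0; apply: filterS => n un; apply: sW => x /un.
by rewrite distrC.
Qed.

Lemma Ck_ext (f g : Ck X R) : (forall x, f x = g x) -> f = g.
Proof. by move=> fg; apply/continuousEP. Qed.

Lemma Ck_accessible : accessible_space (Ck X R).
Proof.
move=> f g /eqP fg.
have [x fgx] : exists x, f x <> g x.
  by apply: contra_notP fg => /forallNP fg; apply: Ck_ext => x; apply: contrapT.
have d0 : 0 < `|f x - g x| by rewrite normr_gt0 subr_eq0; exact/eqP.
pose W := [set h : Ck X R | forall y, [set x] y -> `|f y - h y| < `|f x - g x|].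
have nW : nbhs f W.
  by apply/Ck_nbhsP; exists [set x], `|f x - g x|; split=> //; exact: compact_set1.
exists W°; split; [exact: open_interior | by rewrite inE |].
by rewrite inE => /interior_subset/(_ x erefl); rewrite ltxx.
Qed.

Lemma k_null_add u w : k_null u -> k_null w -> k_null (fun n x => u n x + w n x).
Proof.
move=> u0 w0 C e cC e0; have e20 : 0 < e / 2 by lra.
apply: filterS2 (u0 _ _ cC e20) (w0 _ _ cC e20) => n un wn x Cx.
by apply: le_lt_trans (ler_normD _ _) _; have := un x Cx; have := wn x Cx; lra.
Qed.

Lemma k_null_le u w : (forall n x, `|u n x| <= `|w n x|) -> k_null w -> k_null u.
Proof.
move=> uw w0 C e cC e0; apply: filterS (w0 C e cC e0) => n wn x Cx.
exact: le_lt_trans (uw n x) (wn x Cx).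
Qed.

Lemma k_null_scale u (c : R) : k_null u -> k_null (fun n x => c * u n x).
Proof.
move=> u0 C e cC e0; have c0 : 0 < `|c| + 1 by have := normr_ge0 c; lra.
apply: filterS (u0 C _ cC (divr_gt0 e0 c0)) => n un x /un ux.
rewrite normrM; apply: (@le_lt_trans _ _ ((`|c| + 1) * `|u n x|)).
  by rewrite ler_wpM2r//; lra.
by rewrite mulrC -ltr_pdivlMr.
Qed.

Lemma k_null_inv : k_null (fun n _ => n.+1%:R^-1).
Proof.
move=> C e _ e0; apply: filterS (near_infty_natSinv_lt (PosNum e0)) => n /= ne x _.
by rewrite ger0_norm// invr_ge0.
Qed.

Lemma k_null_sum (F : nat -> nat -> X -> R) n :
  (forall i, k_null (F i)) -> k_null (fun m x => \sum_(i < n) F i m x).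
Proof.
move=> F0; elim: n => [|n IHn].
  by move=> C e cC e0; apply: nearW => m x _; rewrite big_ord0 normr0.
under [X in k_null X]eq_fun do under eq_fun do rewrite big_ord_recr.
exact: k_null_add.
Qed.

Lemma k_null_subseq u (s : nat -> nat) :
  (forall n, (n <= s n)%N) -> k_null u -> k_null (fun n => u (s n)).
Proof.
move=> ns u0 C e cC e0; have [N _ NP] := u0 C e cC e0.
by exists N => // n /= Nn; apply: NP; exact: leq_trans (ns n).
Qed.

Lemma Ck_null_Gamma (u : nat -> Ck X R) : k_null (fun n => u n : X -> R) ->
  (forall n, exists x, u n x <> 0) -> Gamma_at (Ck0 X R) (range u).
Proof.
move=> u0 neq; apply: cvg_Gamma_at; first exact: Ck_accessible.
  by apply/Ck_cvgP; apply: k_null_le u0 => n x /=; rewrite subr0.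
by move=> n un0; have [x] := neq n; rewrite un0.
Qed.

Lemma Gamma_Ck_null (A : set (Ck X R)) : Gamma_at (Ck0 X R) A ->
  exists u : nat -> Ck X R,
  [/\ forall n, A (u n), forall n, exists x, u n x <> 0, escaping u &
      k_null (fun n => u n : X -> R)].
Proof.
move=> GA; have [infA nA0 _] := GA; have [u [Au eu]] := infinite_escaping infA.
exists u; split=> // [n|].
  apply: contra_notP nA0 => /forallNP un0; suff <- : u n = Ck0 X R by [].
  by apply: Ck_ext => x; apply: contrapT.
have /Ck_cvgP := Gamma_at_cvg GA Au eu.
by apply: k_null_le => n x /=; rewrite subr0.
Qed.


(** * The diagonal property *)

(** Property alpha_2 at the zero function, stated for double sequences of
    plain functions: the rows may contain the zero function and repetitions,
    so that differences of members of C_k(X) can be used as entries. *)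
Definition alpha2 : Prop := forall F : nat -> nat -> X -> R,
  (forall n m, continuous (F n m)) -> (forall n, k_null (F n)) ->
  exists phi : nat -> nat, k_null (fun n => F n (phi n)).

(** The form in which a finite selection is exploited: the j-th function comes
    from row [j] or a later one, with no row prescribed. *)
Definition late_bound (F : nat -> nat -> X -> R) : Prop :=
  exists nu mu : nat -> nat, (forall j, (j <= nu j)%N) /\
    forall C, compact C ->
    \forall j \near \oo, forall x, C x -> F (nu j) (mu j) x < 1.

(** The weights [n.+1] turn the single bound 1 into convergence to zero, and
    the partial sums let an entry of row [nu j] dominate the entry of row [j]
    in the same column. Having each function take a value at least 1 costs nothing:
    functions below 1 everywhere either occur in arbitrarily late rows, and
    are then selected at once, or disappear with the first rows. *)
Lemma late_bound_alpha2 :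
  (forall F : nat -> nat -> X -> R, (forall n m, continuous (F n m)) ->
    (forall n m x, 0 <= F n m x) -> (forall n, k_null (F n)) ->
    (forall n m, exists x, 1 <= F n m x) -> late_bound F) -> alpha2.
Proof.
move=> late F cF F0.
pose G n m x := n.+1%:R * \sum_(i < n.+1) `|F i m x|.
have cG n m : continuous (G n m).
  move=> x; apply: (@continuousM R X (fun=> n.+1%:R)
    (fun x => \sum_(i < n.+1) `|F i m x|)); first exact: cvg_cst.
  have := @continuous_big R 'I_n.+1 +%R 0 xpredT (@add_continuous _) X
    (index_enum _) (fun i x => `|F i m x|).
  by apply => i _ y; apply: cvg_norm; exact: cF.
have G_ge0 n m x : 0 <= G n m x by rewrite mulr_ge0// sumr_ge0.
have G0 n : k_null (G n).
  apply: k_null_scale; apply: (@k_null_sum (fun i m x => `|F i m x|)) => i.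
  by apply: k_null_le (F0 i) => m x; rewrite normr_id.
have [nu [mu [nuj Glt]]] : late_bound G.
  have [[N GN]|nN] := pselect (exists N, forall n m, (N <= n)%N ->
      exists x, 1 <= G n m x).
    have [||||nu [mu [nuj Glt]]] := late (fun n => G (N + n)%N) => //.
      by move=> n m; apply: GN; exact: leq_addr.
    exists (fun j => N + nu j)%N, mu; split=> // j.
    exact: leq_trans (nuj j) (leq_addl _ _).
  suff /choice[p pP] : forall j, exists p : nat * nat,
      (j <= p.1)%N /\ forall x, G p.1 p.2 x < 1.
    exists (fun j => (p j).1), (fun j => (p j).2); split=> [j|C _].
      by case: (pP j).
    by apply: nearW => j x _; case: (pP j).
  move=> j; apply: contra_notP nN => nP; exists j => n m jn.
  apply: contra_notP nP => nx; exists (n, m); split=> //= x.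
  by rewrite ltNge; apply/negP => Gx; apply: nx; exists x.
exists mu => C e cC e0; have := Glt C cC.
apply: filterS2 (@k_null_inv C e cC e0) => j je GC x Cx.
apply: le_lt_trans (je x Cx); rewrite (@ger0_norm _ j.+1%:R^-1) ?invr_ge0//.
have := GC x Cx; rewrite /G mulrC -ltr_pdivlMr// div1r => /ltW Gx.
have jnu : (j < (nu j).+1)%N by rewrite ltnS.
apply: (@le_trans _ _ (nu j).+1%:R^-1); last first.
  by rewrite lef_pV2 ?posrE// ler_nat ltnS.
apply: le_trans Gx; rewrite (bigD1 (Ordinal jnu))//= lerDl.
by rewrite sumr_ge0.
Qed.

(** * From finite selections to the diagonal property *)

Definition cut (t : R) : R := Num.max 0 (Num.min 1 (2 - 2 * t)).

Lemma cut1 t : t <= 2^-1 -> cut t = 1.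
Proof. by move=> t2; rewrite /cut min_l ?max_r//; lra. Qed.

Lemma cut0 t : 1 <= t -> cut t = 0.
Proof. by move=> t1; rewrite /cut max_l// ge_min; apply/orP; right; lra. Qed.

Lemma continuous_cut h : continuous h -> continuous (cut \o h).
Proof.
move=> ch x; apply: (@continuous_max R X (fun=> 0) _ x); first exact: cvg_cst.
apply: (@continuous_min R X (fun=> 1) _ x); first exact: cvg_cst.
apply: (@continuousB R R^o X (fun=> 2)); first exact: cvg_cst.
by apply: (@continuousM R X (fun=> 2)); [exact: cvg_cst | exact: ch].
Qed.

(** Interpolates between [f], where [g <= 1/2], and 1, where [g >= 1]. *)
Definition damp g f : X -> R := fun x => 1 + cut (g x) * (f x - 1).

Lemma continuous_damp g f : continuous g -> continuous f -> continuous (damp g f).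
Proof.
move=> cg cf x; apply: (@continuousD R R^o X (fun=> 1)); first exact: cvg_cst.
apply: (@continuousM R X); first exact: continuous_cut.
by apply: (@continuousB R R^o X); [exact: cf | exact: cvg_cst].
Qed.

(** On a given compact set [G m] is eventually at most 1/2, and then the damped
    function coincides with [d i] there. *)
Lemma seq_dense_damp (d : nat -> Ck X R) (G : nat -> X -> R)
    (cG : forall m, continuous (G m)) :
  (forall y : Ck X R, exists s : nat -> nat, d \o s @ \oo --> y) -> k_null G ->
  seq_dense [set f : Ck X R | exists m i, f = damp (G m) (d i) :> (X -> R)].
Proof.
move=> dd G0 y; have [s /Ck_cvgP sy] := dd y.
exists (fun k => Ck_of (continuous_damp (cG k) (@Ck_continuous (d (s k))))).
split=> [k|]; first by exists k, (s k).
apply/Ck_cvgP => C e cC e0.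
have h0 : (0 : R) < 2^-1 by lra.
apply: filterS2 (sy C e cC e0) (G0 C _ cC h0) => k yk Gk x Cx.
rewrite -[X in X x]/(damp (G k) (d (s k))) /damp cut1; last first.
  by apply: ltW; apply: le_lt_trans (Gk x Cx); exact: ler_norm.
by have := yk x Cx; rewrite /= mul1r [1 + _]addrC subrK.
Qed.

Lemma bigcup_Gamma_null (B : nat -> set (Ck X R)) :
  (forall n, finite_set (B n)) -> Gamma_at (Ck0 X R) (\bigcup_n B n) ->
  exists (nu : nat -> nat) (v : nat -> Ck X R),
  [/\ forall j, (j <= nu j)%N, forall j, B (nu j) (v j) &
      k_null (fun n => v n : X -> R)].
Proof.
move=> finB GB; have [infB _ _] := GB.
have [nu [v [nuj Bv ev]]] := bigcup_escaping finB infB.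
exists nu, v; split=> //.
have /Ck_cvgP : v @ \oo --> Ck0 X R.
  by apply: Gamma_at_cvg GB _ ev => n; exists (nu n).
by apply: k_null_le => n x /=; rewrite subr0.
Qed.

Lemma seq_separable_enum : seq_separable (Ck X R) ->
  exists d : nat -> Ck X R,
    forall y : Ck X R, exists s : nat -> nat, d \o s @ \oo --> y.
Proof.
move=> [D [/pfcard_geP[D0|[d]] Dd]].
  by have [u [Du _]] := Dd (Ck0 X R); have := Du 0; rewrite D0.
exists d => y; have [u [Du uy]] := Dd y.
have /choice[s su] : forall n, exists i, d i = u n.
  by move=> n; have [i _ <-] := @surj _ _ _ _ d _ (Du n); exists i.
by exists s; rewrite (_ : d \o s = u)//; apply/funext => n /=.
Qed.

(** The assumption is what S_fin(S, S) and S_fin(S, Gamma_0) have in common.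
    The damped functions equal 1 wherever the entry of [F] is at least 1; in
    particular they are not zero, and a sequence of them can tend to zero only
    if the entries drop below 1 on every compact set. *)
Lemma dense_selection_alpha2 : seq_separable (Ck X R) ->
  (forall D : nat -> set (Ck X R),
    (forall n, seq_dense (D n)) -> (forall n, ~ D n (Ck0 X R)) ->
    exists B : nat -> set (Ck X R), (forall n, finite_set (B n) /\ B n `<=` D n) /\
      Gamma_at (Ck0 X R) (\bigcup_n B n)) -> alpha2.
Proof.
move=> /seq_separable_enum[d dd] sel; apply: late_bound_alpha2.
move=> F cF F_ge0 F0 F1.
pose D n := [set f : Ck X R | exists m i, f = damp (F n m) (d i) :> (X -> R)].
have D1 n m i x : 1 <= F n m x -> damp (F n m) (d i) x = 1.
  by move=> Fx; rewrite /damp cut0// mul0r addr0.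
have [||B [BD GB]] := sel D.
- by move=> n; apply: seq_dense_damp.
- move=> n [m [i E]]; have [x Fx] := F1 n m.
  have := D1 n m i x Fx; rewrite -E /= => /esym/eqP.
  by rewrite oner_eq0.
have [nu [v [nuj Bv v0]]] := bigcup_Gamma_null (fun n => (BD n).1) GB.
have /choice[mu muP] : forall j, exists m, exists i,
    v j = damp (F (nu j) m) (d i) :> (X -> R).
  by move=> j; have [m [i E]] := (BD (nu j)).2 _ (Bv j); exists m, i.
exists nu, mu; split=> // C cC; apply: filterS (v0 C 1 cC ltr01) => j vj x Cx.
rewrite ltNge; apply/negP => Fx; have [i E] := muP j.
by have := vj x Cx; rewrite E D1// normr1 ltxx.
Qed.

Lemma seq_dense_Gamma (W : set (Ck X R)) : seq_dense W -> ~ W (Ck0 X R) ->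
  exists2 A, A `<=` W & Gamma_at (Ck0 X R) A.
Proof.
move=> dW W0; have [u [Wu u0]] := dW (Ck0 X R).
exists (range u); first by move=> _ [n _ <-].
apply: cvg_Gamma_at => //; first exact: Ck_accessible.
by move=> n un0; apply: W0; rewrite -un0.
Qed.

Lemma Sfin_dense_Gamma_alpha2 : seq_separable (Ck X R) ->
  Sfin (@seq_dense (Ck X R)) (Gamma_at (Ck0 X R)) -> alpha2.
Proof.
by move=> sep sel; apply: dense_selection_alpha2 => // D dD _; exact: sel.
Qed.

Lemma Sfin_dense_dense_alpha2 : seq_separable (Ck X R) ->
  Sfin (@seq_dense (Ck X R)) (@seq_dense (Ck X R)) -> alpha2.
Proof.
move=> sep sel; apply: dense_selection_alpha2 => // D dD D0.
have [B [BD dB]] := sel D dD.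
have [|A AB GA] := seq_dense_Gamma dB.
  by move=> [n _ /(BD n).2]; exact: D0.
exists (fun n => B n `&` A); split=> [n|].
  by split=> [|f [/(BD n).2]//]; apply: finite_setIl; case: (BD n).
by rewrite -setI_bigcupl setIidr.
Qed.

Lemma Sfin_Gamma_alpha2 :
  Sfin (Gamma_at (Ck0 X R)) (Gamma_at (Ck0 X R)) -> alpha2.
Proof.
move=> sel; apply: late_bound_alpha2 => F cF F_ge0 F0 F1.
have [n|B [BF GB]] := sel (fun n => range (fun m => Ck_of (cF n m))).
  apply: Ck_null_Gamma => [|m]; first exact: F0.
  have [x Fx] := F1 n m; exists x => /= F0x.
  by move: Fx; rewrite (_ : F n m x = 0)// ler10.
have [nu [v [nuj Bv v0]]] := bigcup_Gamma_null (fun n => (BF n).1) GB.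
have /choice[mu muP] : forall j, exists m, Ck_of (cF (nu j) m) = v j.
  by move=> j; have [m _ E] := (BF (nu j)).2 _ (Bv j); exists m.
exists nu, mu; split=> // C cC; apply: filterS (v0 C 1 cC ltr01) => j vj x Cx.
by apply: le_lt_trans (vj x Cx); rewrite -muP; exact: ler_norm.
Qed.

(** The sets [U n m] below are proper because each [F n m] takes a value at least
    1, which is
    what being a cover in the sense of [gamma_k_cover] demands. *)
Lemma Sfin_cover_alpha2 : Sfin (Gamma_k_sh X R) (Gamma_k X) -> alpha2.
Proof.
move=> sel; apply: late_bound_alpha2 => F cF F_ge0 F0 F1.
pose U n m := [set x | F n m x < 1].
pose Z n m := [set x | F n m x <= 2^-1].
have ZU n m : Z n m `<=` U n m by move=> x /=; rewrite /Z/U/=; lra.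
have UT n m : U n m <> setT.
  move=> UT; have [x] := F1 n m; rewrite leNgt => /negP; apply.
  by have : U n m x by rewrite UT.
have ZC n C : compact C -> \forall m \near \oo, C `<=` Z n m.
  move=> cC; have h0 : (0 : R) < 2^-1 by lra.
  apply: filterS (F0 n C _ cC h0) => m Fm x Cx; apply: ltW.
  by apply: le_lt_trans (Fm x Cx); exact: ler_norm.
have cozU n m : cozero_set R (U n m).
  exists (fun x => Num.max 0 (1 - F n m x)); split=> [x|].
    apply: (@continuous_max R X (fun=> 0)); first exact: cvg_cst.
    by apply: (@continuousB R R^o X (fun=> 1)); [exact: cvg_cst|exact: cF].
  apply/seteqP; split=> x; rewrite /U /=.
    by move=> Fx; rewrite max_r ?gt_eqF//; lra.
  by apply: contra_neqT; rewrite -leNgt => Fx; rewrite max_l//; lra.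
have zerZ n m : zero_set R (Z n m).
  exists (fun x => Num.max 0 (F n m x - 2^-1)); split=> [x|].
    apply: (@continuous_max R X (fun=> 0)); first exact: cvg_cst.
    by apply: (@continuousB R R^o X); [exact: cF|exact: cvg_cst].
  apply/seteqP; split=> x; rewrite /Z /=.
    by move=> Fx; rewrite max_l//; lra.
  by move=> Fx; rewrite leNgt; apply/negP => Fx2; move: Fx; rewrite max_r; lra.
have gU n : gamma_k_cover (range (U n)).
  apply: gamma_k_cover_range => // C cC; apply: filterS (ZC n C cC) => m CZ.
  exact: subset_trans (@ZU n m).
have [n|B [BU [GB _]]] := sel (fun n => range (U n)).
  split=> // [V [m _ <-]//|].
  (* Distinct columns may give the same set, so the shrinking has to pick one
     column [s V] for each member [V]. *)
  have /choice[s sP] : forall V, exists m, range (U n) V -> U n m = V.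
    move=> V; have [[m _ <-]|nV] := pselect (range (U n) V); first by exists m.
    by exists 0 => /nV.
  exists (fun V => Z n (s V)); split=> [V /sP VE|].
    by split=> //; rewrite -[X in _ `<=` X]VE.
  have [_ infU _ _] := gU n.
  apply: gamma_k_cover_image => // [V UV ZT|C cC].
    by apply: (UT n (s V)); apply/seteqP; split=> // x _; apply: ZU; rewrite ZT.
  have [N _ NC] := ZC n C cC.
  apply: (@sub_finite_set _ _ (U n @` `I_N)); last exact: finite_image.
  move=> V [/sP VE nC]; exists (s V) => //=.
  by rewrite ltnNge; apply/negP => /NC.
have [_ infB _ _] := GB.
have [nu [v [nuj Bv ev]]] := bigcup_escaping (fun n => (BU n).1) infB.
have /choice[mu muP] : forall j, exists m, U (nu j) m = v j.
  by move=> j; have [m _ E] := (BU (nu j)).2 _ (Bv j); exists m.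
exists nu, mu; split=> // C cC.
have := gamma_k_cover_near GB (fun j => ex_intro2 _ _ (nu j) I (Bv j)) ev cC.
by apply: filterS => j Cv x /Cv; rewrite -muP.
Qed.

(** * From the diagonal property to single selections *)

Lemma alpha2_S1_Gamma :
  alpha2 -> S1 (Gamma_at (Ck0 X R)) (Gamma_at (Ck0 X R)).
Proof.
move=> a2 A GA.
have /choice[u uP] := fun n => Gamma_Ck_null (GA n).
have [||phi phi0] := a2 (fun n m => u n m : X -> R).
- by move=> n m; exact: Ck_continuous.
- by move=> n; case: (uP n).
exists (fun n => u n (phi n)); split=> [n|]; first by case: (uP n).
by apply: Ck_null_Gamma => // n; case: (uP n).
Qed.

(** A sequence in [D n] converging to zero could consist of zeros only; the
    n-th row therefore converges to 1/(n+1), and is restricted to functions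
    that do not vanish at [x0]. *)
Lemma alpha2_S1_dense_Gamma (x0 : X) :
  alpha2 -> S1 (@seq_dense (Ck X R)) (Gamma_at (Ck0 X R)).
Proof.
move=> a2 D dD.
have cc n : continuous (fun _ : X => n.+1%:R^-1 : R) by move=> x; exact: cvg_cst.
have /choice[u uP] : forall n, exists u : nat -> Ck X R,
    [/\ forall m, D n (u m), forall m, u m x0 <> 0 &
      k_null (fun m x => u m x - n.+1%:R^-1)].
  move=> n; have [u [Du /Ck_cvgP u0]] := dD n (Ck_of (cc n)).
  have i0 : (0 : R) < n.+1%:R^-1 by rewrite invr_gt0.
  have [N _ NP] := u0 _ _ (@compact_set1 X x0) i0.
  exists (fun m => u (N + m)%N); split=> // [m ux0|].
    have /(_ x0 erefl) := NP (N + m)%N (leq_addr _ _).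
    by rewrite ux0 sub0r normrN ger0_norm ?ltxx// ltW.
  by apply: (k_null_subseq (s := addn N)) u0 => m; exact: leq_addl.
have [||phi phi0] := a2 (fun n m x => u n m x - n.+1%:R^-1).
- move=> n m x; apply: (@continuousB R R^o X); first exact: Ck_continuous.
  exact: cvg_cst.
- by move=> n; case: (uP n).
exists (fun n => u n (phi n)); split=> [n|]; first by case: (uP n).
apply: Ck_null_Gamma => [|n]; last by exists x0; case: (uP n).
apply: k_null_le (k_null_add phi0 k_null_inv) => n x.
by rewrite subrK.
Qed.

(** Row [n] converges to [d i] where [i] is the exponent of 2 in [n]. Each [i]
    belongs to arbitrarily large [n], so along [r] below the targets run
    through [d (s k)] while the row indices tend to infinity. *)
Lemma alpha2_S1_dense : seq_separable (Ck X R) ->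
  alpha2 -> S1 (@seq_dense (Ck X R)) (@seq_dense (Ck X R)).
Proof.
move=> /seq_separable_enum[d dd] a2 D dD.
have /choice[u uP] : forall n, exists u : nat -> Ck X R,
    (forall m, D n (u m)) /\ k_null (fun m x => u m x - d (logn 2 n) x).
  move=> n; have [u [Du /Ck_cvgP u0]] := dD n (d (logn 2 n)).
  by exists u.
have [||phi phi0] := a2 (fun n m x => u n m x - d (logn 2 n) x).
- move=> n m x; apply: (@continuousB R R^o X); exact: Ck_continuous.
- by move=> n; case: (uP n).
exists (fun n => u n (phi n)); split=> [n|y]; first by case: (uP n).
have [s /Ck_cvgP sy] := dd y.
pose r k := (2 ^ s k * k.*2.+1)%N.
have rk k : (k <= r k)%N.
  rewrite /r; apply: (@leq_trans k.*2.+1).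
    by rewrite ltnW// ltnS -addnn leq_addr.
  by rewrite leq_pmull// expn_gt0.
have r2 k : logn 2 (r k) = s k.
  rewrite /r lognM ?expn_gt0// pfactorK// lognE /=.
  by rewrite dvdn2 /= odd_double /= addn0.
exists (fun k => u (r k) (phi (r k))); split=> [k|]; first by exists (r k).
apply/Ck_cvgP; apply: k_null_le (k_null_add (k_null_subseq rk phi0) sy) => k x.
by rewrite /= r2 addrA subrK.
Qed.

Lemma zero_cozero_separation (Z V : set X) :
  zero_set R Z -> cozero_set R V -> Z `<=` V ->
  exists f : X -> R, [/\ continuous f, forall x, Z x -> f x = 0 &
    forall x, ~ V x -> f x = 1].
Proof.
move=> [z [cz ->]] [c [cc ->]] ZV.
have pos x : `|z x| + `|c x| != 0.
  rewrite paddr_eq0// !normr_eq0; apply/negP => /andP[/eqP zx /eqP cx].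
  by have := ZV x zx; rewrite /= cx eqxx.
exists (fun x => `|z x| / (`|z x| + `|c x|)); split=> [x|x /= ->|x /=].
- apply: (@continuousM R X (fun x => `|z x|));
    first by apply: cvg_norm; exact: cz.
  apply: (@continuousV R X (fun x => `|z x| + `|c x|)) => //.
  apply: (@continuousD R R^o X (fun x => `|z x|));
    first by apply: cvg_norm; exact: cz.
  by apply: cvg_norm; exact: cc.
- by rewrite normr0 mul0r.
- move=> /negP; rewrite negbK => /eqP cx; have := pos x.
  by rewrite cx normr0 addr0 => /divff.
Qed.

(** Choosing the columns through the shrinking [F @` U n], rather than through
    [U n], makes the zero-sets of a row leave every finite family even when [F]
    is not injective. *)
Lemma alpha2_S1_cover : alpha2 -> S1 (Gamma_k_sh X R) (Gamma_k X).
Proof.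
move=> a2 U GU.
have /choice[p pP] : forall n, exists p : (nat -> set X) * (nat -> X -> R),
    [/\ forall m, U n (p.1 m), forall m, continuous (p.2 m), k_null p.2 &
      forall m x, ~ p.1 m x -> p.2 m x = 1].
  move=> n; have [_ cozU [F [FU gF]]] := GU n.
  have [_ infF _ _] := gF; have [Z [FZ eZ]] := infinite_escaping infF.
  have /choice[V VP] : forall m, exists V, U n V /\ F V = Z m.
    by move=> m; have [V UV FV] := FZ m; exists V.
  have /choice[f fP] : forall m, exists f : X -> R, [/\ continuous f,
      forall x, Z m x -> f x = 0 & forall x, ~ V m x -> f x = 1].
    move=> m; have [UV FV] := VP m; have [zF sF] := FU _ UV.
    by apply: zero_cozero_separation; rewrite -?FV//; exact: cozU.
  exists (V, f); split=> /= [m|m|C e cC e0|m]; try by case: (VP m).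
  - by case: (fP m).
  - have := gamma_k_cover_near gF FZ eZ cC.
    apply: filterS => m CZ x /CZ Zx; case: (fP m) => _ /(_ x Zx) -> _.
    by rewrite normr0.
  - by case: (fP m).
have [n m|n|phi phi0] := a2 (fun n => (p n).2); try by case: (pP n).
have UV n : U n ((p n).1 (phi n)) by case: (pP n).
exists (fun n => (p n).1 (phi n)); split=> //; split; last first.
  move=> _ [n _ <-]; have [_ cozU _] := GU n.
  have [c [cc ->]] := cozU _ (UV n).
  by apply: open_comp (@open_neq R 0) => x _; exact: cc.
apply: gamma_k_cover_range => [n VT|C cC].
  by have [[_ _ UT _] _ _] := GU n; apply: UT; rewrite -VT.
apply: filterS (phi0 C 1 cC ltr01) => n fn x Cx; apply: contrapT => nV.
case: (pP n) => _ _ _ /(_ _ _ nV) f1.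
by have := fn x Cx; rewrite f1 normr1 ltxx.
Qed.

End function_space.

Theorem theorem3p5 (R : realType) (X : topologicalType)
    (X_nonempty : [set: X] !=set0)
    (X_tychonoff : tychonoff_space X)
    (CkX_seq_separable : seq_separable (Ck X R)) :
  [<->
    S1 (@seq_dense (Ck X R)) (@seq_dense (Ck X R));
    S1 (@seq_dense (Ck X R)) (Gamma_at (Ck0 X R));
    S1 (Gamma_at (Ck0 X R)) (Gamma_at (Ck0 X R));
    S1 (Gamma_k_sh X R) (Gamma_k X);
    Sfin (@seq_dense (Ck X R)) (@seq_dense (Ck X R));
    Sfin (@seq_dense (Ck X R)) (Gamma_at (Ck0 X R));
    Sfin (Gamma_at (Ck0 X R)) (Gamma_at (Ck0 X R));
    Sfin (Gamma_k_sh X R) (Gamma_k X)].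
Proof.
have [x0 _] := X_nonempty; have sep := CkX_seq_separable.
tfae.
- move=> /S1_Sfin /(Sfin_dense_dense_alpha2 sep).
  exact: alpha2_S1_dense_Gamma x0.
- by move=> /S1_Sfin /(Sfin_dense_Gamma_alpha2 sep) /alpha2_S1_Gamma.
- by move=> /S1_Sfin /Sfin_Gamma_alpha2 /alpha2_S1_cover.
- by move=> /S1_Sfin /Sfin_cover_alpha2 /(alpha2_S1_dense sep) /S1_Sfin.
- by move=> /(Sfin_dense_dense_alpha2 sep) /(alpha2_S1_dense_Gamma x0) /S1_Sfin.
- by move=> /(Sfin_dense_Gamma_alpha2 sep) /alpha2_S1_Gamma /S1_Sfin.
- by move=> /Sfin_Gamma_alpha2 /alpha2_S1_cover /S1_Sfin.
- by move=> /Sfin_cover_alpha2 /(alpha2_S1_dense sep).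
Qed.
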